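(* Let $L$ be a perfect Lie algebra over a field $\mathbb{F}$ of characteristic not $2$, regarded as a trivial Lie hyperalgebra, and let $\mathcal{S}=\bigcap_{n\ge1}\mathcal{S}_n^*$. Then $L/\mathcal{S}=0$, $L/\mathcal{L}\cong L$, and $$\mathcal{L}=\{(x,x)\mid x\in L\}\subseteq\mathcal{S}=L\times L.$$
   Context: A Lie algebra $L$ with operations $\oplus,\odot$ and bracket $\lfloor-,-\rfloor$ is perfect if $L=L^{(1)}$, where $L^{(1)}=\lfloor L,L\rfloor$ is the span of all $\lfloor x,y\rfloor$, $x,y\in L$. **Trivial Lie hyperalgebra.** $L$ is regarded as a Lie hyperalgebra over the trivial hyperfield $\mathbb{F}$ (field operations with singleton values) via $x+y:=\{x\oplus y\}$, $r\cdot x:=\{r\odot x\}$, $[x,y]:=\{\lfloor x,y\rfloor\}$. Operations are extended to subsets by taking unions over elements, and elements are identified with singletons. Put $[A,B]=\bigcup_{a\in A,b\in B}[a,b]$, $L^{[0]}=L$, and $L^{[i]}=[L^{[i-1]},L^{[i-1]}]$ for $i\ge1$ (so $L^{[i]}$ is the set of brackets, without taking spans). **Hyperbracket functions.** A hyperbracket function $f(g_1,\dots,g_m)$ is an arbitrary composition of the arguments $g_1,\dots,g_m$ using only the (hyper)bracket (a bracket monomial, each argument used once; for $m=1$, $f(g)=g$), extended to subsets. **The relation $\mathcal{S}_n$.** $\mathbb{S}_t$ is the symmetric group on $\{1,\dots,t\}$. For $n\ge1$ and $x,y\in L$, $x\,\mathcal{S}_n\,y$ if and only if there exist: $t\in\mathbb{N}$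 and $\sigma\in\mathbb{S}_t$; for $1\le i\le t$, $m_i\in\mathbb{N}$, a hyperbracket function $f_i$ of $m_i$ arguments, elements $h_{i1},\dots,h_{im_i}\in L$, and $\sigma_i\in\mathbb{S}_{m_i}$ such that $\sigma_i(j)=j$ whenever $h_{ij}\notin L^{[n-1]}$; for $1\le j\le m_i$, $p_{ij}\in\mathbb{N}$ and $\sigma_{ij}\in\mathbb{S}_{p_{ij}}$; for $1\le k\le p_{ij}$, $q_{ijk}\in\mathbb{N}$, $\lambda_{ijk1},\dots,\lambda_{ijkq_{ijk}}\in\mathbb{F}$ and $\sigma_{ijk}\in\mathbb{S}_{q_{ijk}}$; such that $$x\in\sum_{i=1}^t\ell_i,\quad \ell_i=f_i(g_{i1},\dots,g_{im_i}),\quad g_{ij}=\Big(\sum_{k=1}^{p_{ij}}\big(\prod_{r=1}^{q_{ijk}}\lambda_{ijkr}\big)\Big)\cdot h_{ij},$$ $$y\in\sum_{i=1}^t\ell'_i,\quad \ell'_i=f_{\sigma(i)}(g'_{i1},\dots,g'_{im_{\sigma(i)}}),\quad g'_{ij}=A_{\sigma(i)\sigma_{\sigma(i)}(j)}\cdot h_{\sigma(i)\sigma_{\sigma(i)}(j)}\ (1\le j\le m_{\sigma(i)}),$$ where $A_{ij}=\sum_{k=1}^{p_{ij}}B_{ij\sigma_{ij}(k)}$ and $B_{ijk}=\prod_{r=1}^{q_{ijk}}\lambda_{ijk\sigma_{ijk}(r)}$. $\mathcal{S}_n^*$ is the transitive closure of $\mathcal{S}_n$. **The relation $\mathcal{L}$.**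 $x\,\mathcal{L}\,y$ iff $\{x,y\}\subseteq\sum_{i=1}^t\ell_i$ for some $t\in\mathbb{N}$ and some $\ell_i=f_i(g_{i1},\dots,g_{im_i})$ ($1\le i\le t$), where $m_i\in\mathbb{N}$, $f_i$ is a hyperbracket function of $m_i$ arguments and $g_{ij}=\big(\sum_{k=1}^{p_{ij}}\prod_{r=1}^{q_{ijk}}\lambda_{ijkr}\big)\cdot h_{ij}$ with $p_{ij},q_{ijk}\in\mathbb{N}$, $h_{ij}\in L$, $\lambda_{ijkr}\in\mathbb{F}$. **Quotients.** $L/\rho$ carries the operations induced by those of $L$ on classes: $\bar x\oplus\bar y=\overline{x\oplus y}$, $r\odot\bar x=\overline{r\odot x}$, $\lfloor\bar x,\bar y\rfloor=\overline{\lfloor x,y\rfloor}$; $\cong$ is isomorphism of Lie algebras. *)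

(* Defs.v *)
From HB Require Import structures.
From Stdlib Require Import Relation_Operators.
From mathcomp Require Import all_boot all_order all_fingroup all_algebra.
From mathcomp Require Import boolp classical_sets.

Set Implicit Arguments.
Unset Strict Implicit.
Unset Printing Implicit Defensive.

Import GRing.Theory.

Local Open Scope classical_set_scope.
Local Open Scope ring_scope.
Local Open Scope quotient_scope.

HB.mixin Record isLieAlgebra (F : fieldType) L of GRing.Lmodule F L := {
  lie : L -> L -> L;
  lie_linearl : forall (a : F) (x y z : L),
    lie (a *: x + y) z = a *: lie x z + lie y z;
  lie_linearr : forall (a : F) (x y z : L),
    lie x (a *: y + z) = a *: lie x y + lie x z;
  lie_alt : forall x : L, lie x x = 0;
  lie_jacobi : forall x y z : L,
    lie x (lie y z) + lie y (lie z x) + lie z (lie x y) = 0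
}.

#[short(type="lieAlgType")]
HB.structure Definition LieAlgebra (F : fieldType) :=
  { L of isLieAlgebra F L & GRing.Lmodule F L }.

Definition lie_isomorphic (F : fieldType) (L M : lieAlgType F) : Prop :=
  exists phi : {linear L -> M},
    bijective phi /\ forall x y : L, phi (lie x y) = lie (phi x) (phi y).

Definition linear_span (F : fieldType) (V : lmodType F) (A : set V) : set V :=
  [set v | exists (n : nat) (c : 'I_n -> F) (u : 'I_n -> V),
     (forall i, A (u i)) /\ v = \sum_(i < n) c i *: u i].

Definition derived_algebra (F : fieldType) (L : lieAlgType F) : set L :=
  linear_span [set lie x y | x in [set: L] & y in [set: L]].
Arguments derived_algebra {F} L _.

Definition perfect_lie (F : fieldType) (L : lieAlgType F) : Prop :=
  derived_algebra L = [set: L].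

Section Quotient.
Variables (F : fieldType) (L : lieAlgType F).

Record lie_congruence (rho : L -> L -> Prop) : Prop := LieCongruence {
  cong_refl : forall x, rho x x;
  cong_sym : forall x y, rho x y -> rho y x;
  cong_trans : forall x y z, rho x y -> rho y z -> rho x z;
  cong_add : forall x x' y y', rho x x' -> rho y y' -> rho (x + y) (x' + y');
  cong_scale : forall (r : F) x x', rho x x' -> rho (r *: x) (r *: x');
  cong_lie : forall x x' y y',
    rho x x' -> rho y y' -> rho (lie x y) (lie x' y')
}.

Variables (rho : L -> L -> Prop) (rhoP : lie_congruence rho).

Definition cong_rel : rel L := fun x y => `[< rho x y >].

Fact cong_rel_refl : reflexive cong_rel.
Proof. by move=> x; apply/asboolP; apply: (cong_refl rhoP). Qed.

Fact cong_rel_sym : symmetric cong_rel.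
Proof. by move=> x y; apply/asboolP/asboolP; apply: (cong_sym rhoP). Qed.

Fact cong_rel_trans : transitive cong_rel.
Proof.
by move=> y x z /asboolP xy /asboolP yz; apply/asboolP;
   apply: (cong_trans rhoP) xy yz.
Qed.

Canonical cong_equiv :=
  EquivRel cong_rel cong_rel_refl cong_rel_sym cong_rel_trans.

Definition lie_quot := {eq_quot cong_equiv}.
HB.instance Definition _ := Choice.on lie_quot.

Definition lie_class (x : L) : lie_quot := \pi_({eq_quot cong_equiv}) x.
Definition lie_repr (X : lie_quot) : L :=
  generic_quotient.repr (X : {eq_quot cong_equiv}).

Lemma lie_reprK X : lie_class (lie_repr X) = X.
Proof. exact: reprK. Qed.

Lemma lie_classP x y : lie_class x = lie_class y <-> rho x y.
Proof.
split; first by move/eqquotP => /asboolP.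
by move=> xy; apply/eqquotP/asboolP.
Qed.

Lemma rho_repr x : rho (lie_repr (lie_class x)) x.
Proof. by apply/lie_classP; rewrite lie_reprK. Qed.

Definition quot_add (X Y : lie_quot) := lie_class (lie_repr X + lie_repr Y).
Definition quot_scale (r : F) (X : lie_quot) := lie_class (r *: lie_repr X).
Definition quot_lie (X Y : lie_quot) :=
  lie_class (lie (lie_repr X) (lie_repr Y)).

Lemma quot_addE x y :
  quot_add (lie_class x) (lie_class y) = lie_class (x + y).
Proof. by apply/lie_classP/(cong_add rhoP); apply: rho_repr. Qed.

Lemma quot_scaleE r x : quot_scale r (lie_class x) = lie_class (r *: x).
Proof. by apply/lie_classP/(cong_scale rhoP)/rho_repr. Qed.

Lemma quot_lieE x y :
  quot_lie (lie_class x) (lie_class y) = lie_class (lie x y).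
Proof. by apply/lie_classP/(cong_lie rhoP); apply: rho_repr. Qed.

Fact quot_addA : associative quot_add.
Proof.
move=> X Y Z; rewrite -(lie_reprK X) -(lie_reprK Y) -(lie_reprK Z).
by rewrite !quot_addE addrA.
Qed.

Fact quot_addC : commutative quot_add.
Proof. by move=> X Y; rewrite /quot_add addrC. Qed.

Fact quot_add0 : left_id (lie_class 0) quot_add.
Proof. by move=> X; rewrite -(lie_reprK X) quot_addE add0r. Qed.

Fact quot_addN : left_inverse (lie_class 0) (quot_scale (-1)) quot_add.
Proof.
by move=> X; rewrite -(lie_reprK X) quot_scaleE quot_addE scaleN1r addNr.
Qed.

HB.instance Definition _ :=
  GRing.isZmodule.Build lie_quot quot_addA quot_addC quot_add0 quot_addN.

Lemma lie_classD x y : lie_class (x + y) = lie_class x + lie_class y.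
Proof. by rewrite -quot_addE. Qed.

Fact quot_scaleA a b X :
  quot_scale a (quot_scale b X) = quot_scale (a * b) X.
Proof. by rewrite -(lie_reprK X) !quot_scaleE scalerA. Qed.

Fact quot_scale1 : left_id 1 quot_scale.
Proof. by move=> X; rewrite -(lie_reprK X) quot_scaleE scale1r. Qed.

Fact quot_scaleDr : right_distributive quot_scale +%R.
Proof.
move=> a X Y; rewrite -(lie_reprK X) -(lie_reprK Y).
by rewrite -lie_classD !quot_scaleE -lie_classD scalerDr.
Qed.

Fact quot_scaleDl X : {morph quot_scale^~ X : a b / a + b}.
Proof.
move=> a b; rewrite -(lie_reprK X).
by rewrite !quot_scaleE -lie_classD scalerDl.
Qed.

HB.instance Definition _ := GRing.Zmodule_isLmodule.Build F lie_quot
  quot_scaleA quot_scale1 quot_scaleDr quot_scaleDl.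

Lemma lie_classZ a x : lie_class (a *: x) = a *: lie_class x.
Proof. by rewrite -quot_scaleE. Qed.

Fact quot_lie_linearl (a : F) (X Y Z : lie_quot) :
  quot_lie (a *: X + Y) Z = a *: quot_lie X Z + quot_lie Y Z.
Proof.
rewrite -(lie_reprK X) -(lie_reprK Y) -(lie_reprK Z).
rewrite -lie_classZ -lie_classD !quot_lieE.
by rewrite -lie_classZ -lie_classD lie_linearl.
Qed.

Fact quot_lie_linearr (a : F) (X Y Z : lie_quot) :
  quot_lie X (a *: Y + Z) = a *: quot_lie X Y + quot_lie X Z.
Proof.
rewrite -(lie_reprK X) -(lie_reprK Y) -(lie_reprK Z).
rewrite -lie_classZ -lie_classD !quot_lieE.
by rewrite -lie_classZ -lie_classD lie_linearr.
Qed.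

Fact quot_lie_alt (X : lie_quot) : quot_lie X X = 0.
Proof. by rewrite -(lie_reprK X) quot_lieE lie_alt. Qed.

Fact quot_lie_jacobi (X Y Z : lie_quot) :
  quot_lie X (quot_lie Y Z) + quot_lie Y (quot_lie Z X)
    + quot_lie Z (quot_lie X Y) = 0.
Proof.
rewrite -(lie_reprK X) -(lie_reprK Y) -(lie_reprK Z) !quot_lieE.
by rewrite -!lie_classD lie_jacobi.
Qed.

HB.instance Definition _ := isLieAlgebra.Build F lie_quot
  quot_lie_linearl quot_lie_linearr quot_lie_alt quot_lie_jacobi.

End Quotient.

(* Only the operations of a Lie hyperalgebra, without its axioms: they are
   only ever instantiated with singleton-valued operations below. *)
Record hyper_ops (F L : Type) := HyperOps {
  hfadd : F -> F -> set F;
  hfmul : F -> F -> set F;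
  hadd : L -> L -> set L;
  hscale : F -> L -> set L;
  hbracket : L -> L -> set L
}.

Definition trivial_hyper (F : fieldType) (L : lieAlgType F) : hyper_ops F L :=
  {| hfadd := fun a b => [set a + b];
     hfmul := fun a b => [set a * b];
     hadd := fun x y => [set x + y];
     hscale := fun r x => [set r *: x];
     hbracket := fun x y => [set lie x y] |}.

Definition set_ext (T U V : Type) (op : T -> U -> set V)
    (A : set T) (B : set U) : set V :=
  \bigcup_(a in A) \bigcup_(b in B) op a b.

(* A_0 op ... op A_(n-1), bracketed to the left; the junk value set0 at n = 0
   is never used. *)
Definition hyper_big (T : Type) (op : T -> T -> set T) (n : nat)
    (A : 'I_n -> set T) : set T :=
  if codom A is B :: s then foldl (set_ext op) B s else set0.

Inductive btree (I : Type) : Type :=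
  | BLeaf of I
  | BNode of btree I & btree I.

Fixpoint bleaves (I : Type) (b : btree I) : seq I :=
  match b with
  | BLeaf i => [:: i]
  | BNode b1 b2 => bleaves b1 ++ bleaves b2
  end.

(* Each of the m arguments is used exactly once, in any order. As a tree has at
   least one leaf, bmonomial 0 is empty. *)
Record bmonomial (m : nat) := BMonomial {
  bmonomial_tree :> btree 'I_m;
  bmonomial_leaves : perm_eq (bleaves bmonomial_tree) (enum 'I_m)
}.

Section Relations.
Variables (F L : Type) (H : hyper_ops F L).

Fixpoint beval (I : Type) (b : btree I) (g : I -> set L) : set L :=
  match b with
  | BLeaf i => g i
  | BNode b1 b2 => set_ext (hbracket H) (beval b1 g) (beval b2 g)
  end.

Fixpoint bracket_power (i : nat) : set L :=
  if i is j.+1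
  then set_ext (hbracket H) (bracket_power j) (bracket_power j)
  else [set: L].

(* The data of the formal sum of the l_i; the positivity of the m_i follows
   from the existence of the f_i. *)
Record bracket_sum := BracketSum {
  bs_t : nat;
  bs_m : 'I_bs_t -> nat;
  bs_f : forall i, bmonomial (bs_m i);
  bs_h : forall i, 'I_(bs_m i) -> L;
  bs_p : forall i, 'I_(bs_m i) -> nat;
  bs_q : forall i (j : 'I_(bs_m i)), 'I_(bs_p j) -> nat;
  bs_lambda : forall i (j : 'I_(bs_m i)) (k : 'I_(bs_p j)),
    'I_(bs_q k) -> F;
  bs_t_gt0 : (0 < bs_t)%N;
  bs_p_gt0 : forall i (j : 'I_(bs_m i)), (0 < bs_p j)%N;
  bs_q_gt0 : forall i (j : 'I_(bs_m i)) (k : 'I_(bs_p j)), (0 < bs_q k)%N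
}.

Definition bs_value (D : bracket_sum) : set L :=
  hyper_big (hadd H) (fun i : 'I_(bs_t D) =>
    beval (bs_f i) (fun j : 'I_(bs_m i) =>
      set_ext (hscale H)
        (hyper_big (hfadd H) (fun k : 'I_(bs_p j) =>
           hyper_big (hfmul H) (fun r : 'I_(bs_q k) => [set bs_lambda r])))
        [set bs_h j])).

Record bs_perm (D : bracket_sum) := BsPerm {
  sg : 'S_(bs_t D);
  sg1 : forall i : 'I_(bs_t D), 'S_(bs_m i);
  sg2 : forall i (j : 'I_(@bs_m D i)), 'S_(bs_p j);
  sg3 : forall i (j : 'I_(@bs_m D i)) (k : 'I_(bs_p j)), 'S_(bs_q k)
}.

Section Permuted.
Variables (D : bracket_sum) (s : bs_perm D).

Definition perm_B (i : 'I_(bs_t D)) (j : 'I_(bs_m i)) (k : 'I_(bs_p j)) :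
    set F :=
  hyper_big (hfmul H) (fun r : 'I_(bs_q k) => [set bs_lambda (sg3 s k r)]).

Definition perm_A (i : 'I_(bs_t D)) (j : 'I_(bs_m i)) : set F :=
  hyper_big (hfadd H) (fun k : 'I_(bs_p j) => perm_B (sg2 s j k)).

(* l'_i is bs_perm_term (sigma i). *)
Definition bs_perm_term (i : 'I_(bs_t D)) : set L :=
  beval (bs_f i) (fun j : 'I_(bs_m i) =>
    set_ext (hscale H) (perm_A (sg1 s i j)) [set bs_h (sg1 s i j)]).

Definition bs_perm_value : set L :=
  hyper_big (hadd H) (fun i : 'I_(bs_t D) => bs_perm_term (sg s i)).

End Permuted.

(* Only meaningful for 1 <= n. *)
Definition relSn (n : nat) (x y : L) : Prop :=
  exists (D : bracket_sum) (s : bs_perm D),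
    [/\ forall i (j : 'I_(@bs_m D i)),
          ~ bracket_power n.-1 (bs_h j) -> sg1 s i j = j,
        bs_value D x & bs_perm_value s y].

Definition relS (x y : L) : Prop :=
  forall n : nat, (1 <= n)%N -> clos_trans L (relSn n) x y.

Definition relL (x y : L) : Prop :=
  exists D : bracket_sum, [set x; y] `<=` bs_value D.

End Relations.

Definition graph_of (T : Type) (R : T -> T -> Prop) : set (T * T) :=
  [set z | R z.1 z.2].

(* Main.v *)
Require Import Defs.
From Stdlib Require Import Relation_Operators.
From HB Require Import structures.
From mathcomp Require Import all_boot all_order all_fingroup all_algebra.
From mathcomp Require Import boolp classical_sets.

(** Two observations carry the result.

    Every operation of a trivial hyperalgebra is singleton-valued, so the value
    of any formal sum of bracket monomials is a single element of [L]
    ([bs_value_trivial]). Hence [relL] relates [x] only to itself, and dividing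
    by it changes nothing.

    For the other relation, permuting the two arguments of a bracket [[u, v]]
    replaces it by [[v, u] = - [u, v]], and this is allowed at level [n] as soon
    as [u] and [v] lie in [L^[n-1]]. In a perfect algebra every [L^[k]] spans
    [L] ([span_bracket_power]), because [L = [L, L]] and a bracket of linear
    combinations is a linear combination of brackets. So every [z] is a linear
    combination of brackets that may be flipped, and [w + z] is related to
    [w - z] for all [w] and [z] ([relSn_total]). As [2] is invertible, taking
    for [w] half the sum and for [z] half the difference of [x] and [y] relates
    [x] to [y] in one step, at every level [n]. *)

Set Implicit Arguments.
Unset Strict Implicit.
Unset Printing Implicit Defensive.

Import GRing.Theory.

Local Open Scope classical_set_scope.
Local Open Scope ring_scope.

(** * Linear spans *)

Section Span.
Variables (F : fieldType) (V : lmodType F).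
Implicit Types (A : set V) (x y : V).

Lemma span_incl A x : A x -> linear_span A x.
Proof.
move=> Ax; exists 1%N, (fun=> 1), (fun=> x); split=> //.
by rewrite big_ord1 scale1r.
Qed.

Lemma span0 A : linear_span A 0.
Proof.
exists 0%N, (fun=> 0), (fun=> 0); split; first by case.
by rewrite big_ord0.
Qed.

Lemma spanD A x y : linear_span A x -> linear_span A y -> linear_span A (x + y).
Proof.
move=> [n [c [u [Au ->]]]] [m [d [v [Av ->]]]].
exists (n + m)%N,
  (fun i => match split i with inl j => c j | inr j => d j end),
  (fun i => match split i with inl j => u j | inr j => v j end).
split=> [i|]; first by case: (split i).
rewrite big_split_ord /=; congr (_ + _); apply: eq_bigr => i _.
  by rewrite -[lshift m i]/(unsplit (inl i)) unsplitK.
by rewrite -[rshift n i]/(unsplit (inr i)) unsplitK.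
Qed.

Lemma spanZ A a x : linear_span A x -> linear_span A (a *: x).
Proof.
move=> [n [c [u [Au ->]]]]; exists n, (fun i => a * c i), u; split=> //.
by rewrite scaler_sumr; apply: eq_bigr => i _; rewrite scalerA.
Qed.

Lemma span_lincomb A n (c : 'I_n -> F) (u : 'I_n -> V) :
  (forall i, linear_span A (u i)) -> linear_span A (\sum_i c i *: u i).
Proof.
move=> Au; apply: big_ind => [|x y|i _]; [exact: span0 | exact: spanD |].
exact/spanZ/Au.
Qed.

(** A zero combination is padded with a zero multiple of [a], so that the number
    of terms can be taken positive, as formal sums of monomials require. *)
Lemma span_nonempty A a x : A a -> linear_span A x ->
  exists n (c : 'I_n.+1 -> F) (u : 'I_n.+1 -> V),
    (forall i, A (u i)) /\ x = \sum_i c i *: u i.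
Proof.
move=> Aa [[|n] [c [u [Au ->]]]]; last by exists n, c, u.
exists 0%N, (fun=> 0), (fun=> a); split=> //.
by rewrite big_ord0 big_ord1 scale0r.
Qed.

End Span.

Lemma span_image (F : fieldType) (V W : lmodType F) (f : {linear V -> W})
    (A : set V) (B : set W) (x : V) :
  (forall a, A a -> linear_span B (f a)) ->
  linear_span A x -> linear_span B (f x).
Proof.
move=> AB [n [c [u [Au ->]]]]; rewrite linear_sum.
under eq_bigr => i _ do rewrite linearZ.
by apply: span_lincomb => i; apply/AB/Au.
Qed.

(** * Lie algebras *)

Section Lie.
Variables (F : fieldType) (L : lieAlgType F).
Implicit Types x y z : L.

HB.instance Definition _ x :=
  GRing.isLinear.Build F L L *:%R (lie x)
    (fun a y z => lie_linearr a x y z).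

Lemma lieDr x y z : lie x (y + z) = lie x y + lie x z.
Proof. exact: linearD. Qed.

Lemma lieDl x y z : lie (x + y) z = lie x z + lie y z.
Proof. by have := lie_linearl 1 x y z; rewrite !scale1r. Qed.

Lemma lieC x y : lie y x = - lie x y.
Proof.
apply/eqP; rewrite -addr_eq0 addrC; apply/eqP.
by have := lie_alt (x + y); rewrite lieDl !lieDr !lie_alt add0r addr0.
Qed.

Lemma lieZr a x y : lie x (a *: y) = a *: lie x y.
Proof. exact: linearZ. Qed.

Lemma lieZl a x y : lie (a *: x) y = a *: lie x y.
Proof. by rewrite lieC lieZr lieC scalerN opprK. Qed.

Lemma span_lie (A : set L) x y : linear_span A x -> linear_span A y ->
  linear_span [set lie a b | a in A & b in A] (lie x y).
Proof.
move=> Ax Ay; apply: (span_image _ Ay) => b Ab.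
(* Linearity in the second argument is the one known to [span_image], so the
   arguments are exchanged at the cost of a sign. *)
rewrite /= lieC -scaleN1r; apply: spanZ.
apply: (span_image _ Ax) => a Aa.
by apply: span_incl; exists b => //; exists a.
Qed.

Lemma bracket_powerS k :
  bracket_power (trivial_hyper L) k.+1 =
  [set lie a b | a in bracket_power (trivial_hyper L) k
               & b in bracket_power (trivial_hyper L) k].
Proof.
apply/seteqP; split=> [x [a Aa [b Ab ->]]|x [a Aa [b Ab <-]]].
  by exists a => //; exists b.
by exists a => //; exists b.
Qed.

(** Perfectness rewrites [x] as a combination of brackets; by induction the
    arguments of each bracket are combinations of elements of [L^[k]], and
    bilinearity turns the bracket into a combination of elements of
    [L^[k+1]]. *)
Lemma span_bracket_power (hL : perfect_lie L) k x :
  linear_span (bracket_power (trivial_hyper L) k) x.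
Proof.
elim: k x => [|k IHk] x; first exact: span_incl.
have [n [c [u [Lu ->]]]] : derived_algebra L x by rewrite hL.
apply: span_lincomb => i; have [a _ [b _ <-]] := Lu i.
by rewrite bracket_powerS; apply: span_lie.
Qed.

End Lie.

(** * Evaluation in a trivial hyperalgebra *)

Lemma set_ext_set1 (T U V : Type) (f : T -> U -> V) a b :
  set_ext (fun x y => [set f x y]) [set a] [set b] = [set f a b].
Proof. by rewrite /set_ext !bigcup_set1. Qed.

Lemma hyper_big_set1 (T : Type) (idx : T) (f : Monoid.law idx)
    (op : T -> T -> set T) n (a : 'I_n -> T) :
  op = (fun x y => [set f x y]) -> (0 < n)%N ->
  hyper_big op (fun i => [set a i]) = [set \big[f/idx]_i a i].
Proof.
move=> -> n_gt0; rewrite /hyper_big codomE.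
have <- : \big[f/idx]_(i <- enum 'I_n) a i = \big[f/idx]_i a i
  by rewrite enumT [index_enum _]unlock.
have : (0 < size (enum 'I_n))%N by rewrite size_enum_ord.
case: (enum 'I_n) => // i s _ /=.
rewrite -(big_map a predT id) /= -foldlE.
elim: s (a i) => //= j s IHs b; by rewrite set_ext_set1 IHs.
Qed.

Section Evaluation.
Variables (F : fieldType) (L : lieAlgType F).
Local Notation H := (trivial_hyper L).

Fixpoint lie_eval (I : Type) (b : btree I) (g : I -> L) : L :=
  match b with
  | BLeaf i => g i
  | BNode b1 b2 => lie (lie_eval b1 g) (lie_eval b2 g)
  end.

Lemma beval_set1 (I : Type) (b : btree I) (g : I -> L) :
  beval H b (fun i => [set g i]) = [set lie_eval b g].
Proof. by elim: b => //= b1 -> b2 ->; rewrite set_ext_set1. Qed.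

Definition bs_coef (D : bracket_sum F L) i (j : 'I_(@bs_m _ _ D i)) : F :=
  \sum_k \prod_r @bs_lambda _ _ D i j k r.

Lemma bs_value_trivial (D : bracket_sum F L) :
  bs_value H D =
  [set \sum_i lie_eval (@bs_f _ _ D i) (fun j => bs_coef j *: bs_h j)].
Proof.
rewrite /bs_value -(hyper_big_set1 _ (erefl _) (bs_t_gt0 D)); congr hyper_big.
apply: funext => i; rewrite -beval_set1; congr beval; apply: funext => j.
rewrite -set_ext_set1; congr set_ext.
rewrite -(hyper_big_set1 _ (erefl _) (bs_p_gt0 j)); congr hyper_big.
apply: funext => k.
by rewrite -(hyper_big_set1 _ (erefl _) (bs_q_gt0 k)).
Qed.

(** Sums and products in [F] are commutative, so among the permutations only
    those of the terms and of the arguments of the monomials are visible. *)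
Lemma bs_perm_value_trivial (D : bracket_sum F L) (s : bs_perm D) :
  bs_perm_value H s =
  [set \sum_i lie_eval (@bs_f _ _ D (sg s i))
     (fun j => bs_coef (sg1 s (sg s i) j) *: bs_h (sg1 s (sg s i) j))].
Proof.
rewrite /bs_perm_value -(hyper_big_set1 _ (erefl _) (bs_t_gt0 D)).
congr hyper_big; apply: funext => i; rewrite /bs_perm_term -beval_set1.
congr beval; apply: funext => j; rewrite -set_ext_set1; congr set_ext.
rewrite /bs_coef; set j' := sg1 _ _ _.
rewrite (reindex_inj (@perm_inj _ (sg2 s j'))) /=.
rewrite -(hyper_big_set1 _ (erefl _) (bs_p_gt0 j')); congr hyper_big.
apply: funext => k; rewrite (reindex_inj (@perm_inj _ (sg3 s (sg2 s j' k)))) /=.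
by rewrite -(hyper_big_set1 _ (erefl _) (bs_q_gt0 _)).
Qed.

End Evaluation.

(** * The relation [relL] is equality *)

Lemma perm_eq_leaves1 : perm_eq (bleaves (BLeaf (@ord0 0))) (enum 'I_1).
Proof. by rewrite enum_ordSl enum_ord0. Qed.

Definition single_sum (F : fieldType) (L : lieAlgType F) (x : L) :
    bracket_sum F L :=
  @BracketSum F L 1 (fun=> 1%N) (fun=> BMonomial perm_eq_leaves1)
    (fun _ _ => x) (fun _ _ => 1%N) (fun _ _ _ => 1%N) (fun _ _ _ _ => 1)
    isT (fun _ _ => isT) (fun _ _ _ => isT).

Lemma relL_eq (F : fieldType) (L : lieAlgType F) (x y : L) :
  relL (trivial_hyper L) x y <-> x = y.
Proof.
split=> [[D]|<-].
  rewrite bs_value_trivial => sub.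
  by rewrite (sub x (or_introl erefl)) (sub y (or_intror erefl)).
exists (single_sum x); rewrite setUid bs_value_trivial.
by rewrite big_ord1 /= /bs_coef !big_ord1 scale1r.
Qed.

Lemma relL_congruence (F : fieldType) (L : lieAlgType F) :
  lie_congruence (relL (trivial_hyper L)).
Proof.
have -> : relL (trivial_hyper L) = eq.
  by apply: funext => x; apply: funext => y; apply/propext/relL_eq.
by split=> // [x y z -> ->|x x' y y' -> ->|r x x' ->|x x' y y' -> ->].
Qed.

Lemma quot_eq_isomorphic (F : fieldType) (L : lieAlgType F)
    (rho : L -> L -> Prop) (rhoP : lie_congruence rho) :
  (forall x y, rho x y -> x = y) -> lie_isomorphic (lie_quot rhoP) L.
Proof.
move=> rho_eq.
have classK : cancel (lie_class rhoP) (@lie_repr _ _ _ rhoP).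
  by move=> x; apply/rho_eq; exact: rho_repr.
have repr_lin : linear (@lie_repr _ _ _ rhoP).
  move=> a X Y; rewrite -[RHS]classK; congr lie_repr.
  by rewrite lie_classD lie_classZ !lie_reprK.
pose mix := GRing.isLinear.Build F _ L *:%R (@lie_repr _ _ _ rhoP) repr_lin.
pose phi : {linear lie_quot rhoP -> L} :=
  HB.pack (@lie_repr _ _ _ rhoP) mix.
exists phi; split; first by exists (lie_class rhoP); [exact: lie_reprK|].
move=> X Y; rewrite /phi /=; exact: classK.
Qed.

(** * Flipping brackets *)

Section Flip.
Variables (F : fieldType) (L : lieAlgType F).
Local Notation H := (trivial_hyper L).

Lemma perm_eq_leaves2 :
  perm_eq (bleaves (BNode (BLeaf (@ord0 1)) (BLeaf (@ord_max 1)))) (enum 'I_2).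
Proof.
rewrite !enum_ordSl enum_ord0 /=.
by rewrite (_ : lift _ _ = ord_max) //; apply: val_inj.
Qed.

(** The scalar goes with the first argument of the bracket, since only
    arguments of a monomial carry coefficients. *)
Definition lie_sum n (c : 'I_n.+1 -> F) (u v : 'I_n.+1 -> L) :
    bracket_sum F L :=
  @BracketSum F L n.+1 (fun=> 2%N) (fun=> BMonomial perm_eq_leaves2)
    (fun i j => if j == ord0 then u i else v i)
    (fun _ _ => 1%N) (fun _ _ _ => 1%N)
    (fun i j _ _ => if j == ord0 then c i else 1)
    isT (fun _ _ => isT) (fun _ _ _ => isT).

Definition flip_perm n (c : 'I_n.+1 -> F) (u v : 'I_n.+1 -> L)
    (b : 'I_n.+1 -> bool) : bs_perm (lie_sum c u v) :=
  @BsPerm F L (lie_sum c u v) 1%g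
    (fun i => if b i then tperm ord0 ord_max else 1%g)
    (fun _ _ => 1%g) (fun _ _ _ => 1%g).

(** Recording both sides of the relation as one element of [L * L] lets the
    closure of spans under sums and multiples do the work of concatenating and
    rescaling formal sums. *)
Definition flip_pairs n : set (L * L) :=
  [set p | exists u v (b : bool),
     (b -> bracket_power H n.-1 u /\ bracket_power H n.-1 v) /\
     p = (lie u v, if b then lie v u else lie u v)].

(** Each flipped bracket is realised by transposing the two arguments of its
    monomial; level [n] permits this because both arguments lie in
    [L^[n-1]]. *)
Lemma relSn_flip n (p : L * L) :
  linear_span (flip_pairs n) p -> relSn H n p.1 p.2.
Proof.
have flip0 : flip_pairs n (lie 0 0, lie 0 0) by exists 0, 0, false.
move=> /(span_nonempty flip0) [N [c [w [Aw ->]]]].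
have [u uP] := choice Aw; have [v vP] := choice uP; have [b bP] := choice vP.
exists (lie_sum c u v), (flip_perm c u v b); split.
- move=> i j /=; have [+ _] := bP i.
  case: (b i) => [/(_ isT) [Pu Pv]|_ _]; last by rewrite perm1.
  by case: ifP.
- rewrite bs_value_trivial /= raddf_sum; apply: eq_bigr => i _ /=.
  by rewrite /bs_coef /= !big_ord1 /= scale1r lieZl; have [_ ->] := bP i.
- rewrite bs_perm_value_trivial /= raddf_sum; apply: eq_bigr => i _ /=.
  rewrite /bs_coef /= !big_ord1 /= perm1; have [_ ->] /= := bP i.
  case: (b i); first by rewrite tpermL tpermR /= scale1r lieZr.
  by rewrite !perm1 /= scale1r lieZl.
Qed.

Lemma relSn_total (hF : 2%N \notin [pchar F]) (hL : perfect_lie L) n x y :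
  relSn H n x y.
Proof.
have two_neq0 : 2%:R != 0 :> F by move: hF; rewrite inE.
(* The pairs [(w, w)] come from unflipped, the pairs [(z, - z)] from flipped
   brackets. *)
have diag w : linear_span (flip_pairs n) (w, w).
  have fP : linear (fun z : L => (z, z)) by [].
  pose mix := GRing.isLinear.Build F L (L * L)%type *:%R _ fP.
  pose f : {linear L -> (L * L)%type} := HB.pack (fun z : L => (z, z)) mix.
  apply: (span_image (f := f) _ (span_bracket_power hL 1 w)) => _ [u _ [v _ ->]].
  by apply: span_incl; exists u, v, false.
have anti z : linear_span (flip_pairs n) (z, - z).
  have fP : linear (fun z : L => (z, - z)).
    by move=> a s t; rewrite opprD -scalerN.
  pose mix := GRing.isLinear.Build F L (L * L)%type *:%R _ fP.
  pose f : {linear L -> (L * L)%type} := HB.pack (fun z : L => (z, - z)) mix.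
  apply: (span_image (f := f) _ (span_bracket_power hL n.-1.+1 z)).
  move=> _ [u Pu [v Pv ->]].
  by apply: span_incl; exists u, v, true; rewrite /= (lieC u v).
have half t : 2%:R^-1 *: (t + t) = t :> L.
  by rewrite -mulr2n -scaler_nat scalerA mulVf ?scale1r.
have pairE : (x, y) =
    2%:R^-1 *: (((x + y, x + y) : L * L) + (x - y, - (x - y))).
  congr pair => /=; first by rewrite addrACA subrr addr0 half.
  by rewrite opprB [x + y]addrC addrACA subrr addr0 half.
apply: (@relSn_flip n (x, y)); rewrite pairE.
exact/spanZ/spanD.
Qed.

End Flip.

(** * The two quotients *)

Theorem proposition3p6 (F : fieldType) (hF : 2%N \notin [pchar F])
    (L : lieAlgType F) (hL : perfect_lie L) :
  (exists congS : lie_congruence (relS (trivial_hyper L)),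
     forall X : lie_quot congS, X = 0) /\
  (exists congL : lie_congruence (relL (trivial_hyper L)),
     lie_isomorphic (lie_quot congL) L) /\
  graph_of (relL (trivial_hyper L)) = [set (x, x) | x in [set: L]] /\
  [set (x, x) | x in [set: L]] `<=` graph_of (relS (trivial_hyper L)) /\
  graph_of (relS (trivial_hyper L)) = [set: L * L].
Proof.
have relS_total x y : relS (trivial_hyper L) x y.
  by move=> n _; apply: t_step; apply: relSn_total.
split.
  have congS : lie_congruence (relS (trivial_hyper L)) by split.
  exists congS => X; rewrite -(lie_reprK X).
  exact/lie_classP.
split.
  exists (relL_congruence L); apply: quot_eq_isomorphic => x y.
  by move/relL_eq.
split; first last.
  by split=> [z _|]; [|apply/seteqP; split=> // z _]; exact: relS_total.
apply/seteqP; split=> [[x y] /relL_eq /= <-|_ [x _ <-]]; first by exists x.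
exact/relL_eq.
Qed.
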